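(* Let $U$ and $V$ be real Hilbert spaces, $F\colon U\to V$ a bounded linear operator, and $\mathcal{R}\colon U\to[0,+\infty]$ a convex, lower semi-continuous and coercive functional. Let $v^\dagger\in V$ and let $u^\dagger\in\operatorname{arg\,min}_u\{\mathcal{R}(u): Fu=v^\dagger\}$. Assume that $\mathcal{R}$ is locally $p$-convex for some $1\le p<+\infty$ and that for some $0<\nu<1/2$ there exist $\omega^\dagger\in U$ and $$\xi^\dagger:=(F^*F)^\nu\omega^\dagger\in\partial\mathcal{R}(u^\dagger).$$ Then for every $M>0$ there exist constants $C_1,C_2>0$ such that $$\mathcal{D}_{\xi^\dagger}(u_\alpha^\delta,u^\dagger)\le C_1\frac{\delta^2}{\alpha}+C_2\alpha^{\frac{\nu p}{p-1-p\nu+2\nu}}$$ for all $\delta,\alpha>0$ with $\delta^2/\alpha\le M$, all $v^\delta\in V$ with $\lVert v^\delta-v^\dagger\rVert\le\delta$, and all minimisers $u_\alpha^\delta$ of $\mathcal{T}_\alpha(u,v^\delta)=\frac12\lVert Fu-v^\delta\rVert^2+\alpha\mathcal{R}(u)$. In particular, with $a:=\frac{2p-2-2p\nu+4\nu}{p-1+2\nu}$ and a parameter choice $\alpha(\delta)\sim\delta^{a}$ one obtains the convergence rate $\mathcal{D}_{\xi^\dagger}(u_\alpha^\delta,u^\dagger)\lesssim\delta^{\frac{2\nu p}{p-1+2\nu}}$ as $\delta\to0$; that is, for all $0<c\le c'$ there exist $\delta_0>0$ and $C>0$ such that $\mathcal{D}_{\xi^\dagger}(u_\alpha^\delta,u^\dagger)\le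 C\delta^{\frac{2\nu p}{p-1+2\nu}}$ for all $0<\delta\le\delta_0$, all $\alpha$ with $c\,\delta^{a}\le\alpha\le c'\delta^{a}$, all $v^\delta\in V$ with $\lVert v^\delta-v^\dagger\rVert\le\delta$, and all minimisers $u_\alpha^\delta$ of $\mathcal{T}_\alpha(\cdot,v^\delta)$.
   Context: Coercive means $\mathcal{R}(u)\to+\infty$ as $\lVert u\rVert\to\infty$. The subdifferential $\partial\mathcal{R}(u)$ is the set of $\xi\in U$ with $\mathcal{R}(u)<\infty$ and $\mathcal{R}(w)\ge\mathcal{R}(u)+\langle\xi,w-u\rangle$ for all $w\in U$; $\operatorname{dom}\partial\mathcal{R}=\{u:\partial\mathcal{R}(u)\ne\emptyset\}$. Fractional powers $(F^*F)^\nu$ are defined by the spectral calculus. For $\xi\in\partial\mathcal{R}(u)$ the Bregman distance is $\mathcal{D}_\xi(\tilde u,u)=\mathcal{R}(\tilde u)-\mathcal{R}(u)-\langle\xi,\tilde u-u\rangle$. Locally $p$-convex ($1\le p<\infty$): for each $u\in\operatorname{dom}\partial\mathcal{R}$ and every $\rho>0$ there is a constant $C=C(u,\rho)>0$ such that $C\lVert\tilde u-u\rVert^p\le\mathcal{D}_\xi(\tilde u,u)$ for all $\xi\in\partial\mathcal{R}(u)$ and all $\tilde u\in U$ with $\lVert\tilde u-u\rVert\le\rho$. The constants in the claim may depend on all fixed data ($F,\mathcal{R},u^\dagger,\xi^\dagger,\omega^\dagger,\nu,p$, and $M$, respectively $c,c'$) but not on $\delta$, $\alpha$, $v^\delta$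 or the minimiser. *)

(* Defs.v *)
From HB Require Import structures.
From mathcomp Require Import all_boot all_order all_algebra.
From mathcomp Require Import all_classical all_reals all_analysis.

Set Implicit Arguments.
Unset Strict Implicit.
Unset Printing Implicit Defensive.

Import Order.TTheory GRing.Theory Num.Theory.
Import numFieldNormedType.Exports.

Local Open Scope classical_set_scope.
Local Open Scope ring_scope.

HB.mixin Record CompleteNormedModule_isHilbert (R : realType) (T : Type)
    & CompleteNormedModule R T := {
  inner : {dot T for (@idfun R)};
  inner_normE : forall u : T, inner u u = `|u| ^+ 2
}.

#[short(type="hilbertType")]
HB.structure Definition Hilbert (R : realType) :=
  {T of CompleteNormedModule R T & CompleteNormedModule_isHilbert R T}.

Notation "''<' u , v >" := (inner u v)
  (at level 8, u, v at level 69, format "''<' u ,  v >") : ring_scope.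

Section inner_theory.
Context {R : realType} {U : hilbertType R}.
Implicit Types u v w : U.

Lemma innerC u v : '<u, v> = '<v, u>.
Proof. by rewrite hermitian_subproof expr0 mul1r. Qed.

Lemma innerDl u v w : '<u + v, w> = '<u, w> + '<v, w>.
Proof. exact: linearDl. Qed.

Lemma innerDr u v w : '<w, u + v> = '<w, u> + '<w, v>.
Proof. by rewrite innerC innerDl !(innerC _ w). Qed.

Lemma innerZl (a : R) u v : '<a *: u, v> = a * '<u, v>.
Proof. exact: linearZl_LR. Qed.

Lemma innerNl u v : '<- u, v> = - '<u, v>.
Proof. by rewrite -scaleN1r innerZl mulN1r. Qed.

Lemma inner0l v : '<0 : U, v> = 0.
Proof. by rewrite -(scale0r (0 : U)) innerZl mul0r. Qed.

End inner_theory.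

Definition selfadjoint {R : realType} {U : hilbertType R} (T : U -> U) :=
  forall x y, '<T x, y> = '<x, T y>.

(* By the Riesz theorem exactly one function satisfies the defining property,
   so the default value is never used. *)
Definition adjoint {R : realType} {U V : hilbertType R} (F : U -> V) : V -> U :=
  xget (fun=> 0) [set G | forall u v, '<F u, v> = '<u, G v> ].

(* Projection-valued measures on the Borel sets of R. Their values on
   non-measurable sets are irrelevant. *)
Record projMeasure (R : realType) (U : hilbertType R) := ProjMeasure {
  pmeasure :> set (measurableTypeR R) -> U -> U ;
  pm_linear : forall A, measurable A -> linear (pmeasure A) ;
  pm_selfadjoint : forall A, measurable A -> selfadjoint (pmeasure A) ;
  pm_set0 : forall x, pmeasure set0 x = 0 ;
  pm_setT : forall x, pmeasure setT x = x ;
  pm_setI : forall A B, measurable A -> measurable B ->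
    forall x, pmeasure (A `&` B) x = pmeasure A (pmeasure B x) ;
  pm_sigma_additive : forall F : (set (measurableTypeR R))^nat,
    (forall i, measurable (F i)) -> trivIset setT F ->
    forall x, \sum_(0 <= i < n) pmeasure (F i) x @[n --> \oo]
                --> pmeasure (\bigcup_i F i) x
}.

Section spectral_diag.
Context {R : realType} {U : hilbertType R}.
Variables (E : projMeasure U) (x : U).

(* Equal to <E(A) x, x> for measurable A, as E(A) is an orthogonal projection *)
Definition spectral_diag (A : set (measurableTypeR R)) : \bar R :=
  (`|E A x| ^+ 2)%:E.

Let diag0 : spectral_diag set0 = 0%E.
Proof. by rewrite /spectral_diag pm_set0 normr0 expr0n. Qed.

Let diag_ge0 A : (0 <= spectral_diag A)%E.
Proof. by rewrite lee_fin exprn_ge0. Qed.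

Lemma pm_inner A B : measurable A -> measurable B ->
  '<E A x, E B x> = '<x, E (A `&` B) x>.
Proof. by move=> mA mB; rewrite pm_setI// pm_selfadjoint. Qed.

Lemma pm_sum_normE (F : (set (measurableTypeR R))^nat) :
  (forall i, measurable (F i)) -> trivIset setT F -> forall n,
  `|\sum_(0 <= i < n) E (F i) x| ^+ 2 = \sum_(0 <= i < n) `|E (F i) x| ^+ 2.
Proof.
move=> mF tF; elim=> [|n IH]; first by rewrite !big_geq// normr0 expr0n.
rewrite !big_nat_recr//= -IH -!inner_normE innerDl !innerDr.
have s0 : '<\sum_(0 <= i < n) E (F i) x, E (F n) x> = 0.
  rewrite big_mkord; elim/big_ind : _ => [|y z y0 z0|i _].
  - exact: inner0l.
  - by rewrite innerDl y0 z0 addr0.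
  rewrite pm_inner//; move/trivIsetP : tF => ->//.
    by rewrite pm_set0 innerC inner0l.
  by rewrite ltn_eqF.
by rewrite (innerC (E (F n) x)) s0 addr0 add0r.
Qed.

Let diag_sigma_additive : semi_sigma_additive spectral_diag.
Proof.
move=> F mF tF mUF; rewrite /spectral_diag.
under eq_fun do rewrite sumEFin -pm_sum_normE//.
apply: cvg_EFin; first exact: nearW.
rewrite [X in X @ _ --> _](_ : _ =
  fun n => `|\sum_(0 <= i < n) E (F i) x| ^+ 2)//.
rewrite expr2; under eq_fun do rewrite expr2.
by apply: cvgM; apply: cvg_norm; exact: pm_sigma_additive.
Qed.

HB.instance Definition _ := isMeasure.Build _ _ _ spectral_diag
  diag0 diag_ge0 diag_sigma_additive.

End spectral_diag.

(* S is the bounded operator \int f dE; being self-adjoint, it is determined by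
   its quadratic form. *)
Definition spectral_integral {R : realType} {U : hilbertType R}
    (E : projMeasure U) (f : R -> R) (S : U -> U) :=
  [/\ linear S, selfadjoint S &
      forall x, (spectral_diag E x).-integrable setT (EFin \o f) /\
        (\int[spectral_diag E x]_t (f t)%:E)%E = '<S x, x>%:E ].

(* f(T) := \int f dE, for the spectral measure E with T = \int t dE(t). By the
   spectral theorem E exists and is unique if T is bounded and self-adjoint, and
   f(T) exists if moreover f is bounded and measurable on the spectrum of T; the
   default value is not used in that case. *)
Definition spectral_calculus {R : realType} {U : hilbertType R}
    (T : U -> U) (f : R -> R) : U -> U :=
  xget (fun=> 0) [set S | exists2 E : projMeasure U,
    spectral_integral E id T & spectral_integral E f S].

(* For nonnegative T; E does not charge ]-oo, 0[ in that case, so that the values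
   of powR at negative reals do not matter. *)
Definition fractional_power {R : realType} {U : hilbertType R}
    (T : U -> U) (nu : R) : U -> U :=
  spectral_calculus T (fun t => t `^ nu).

Section functionals.
Context {R : realType} {U : hilbertType R}.
Implicit Types (J : U -> \bar R) (xi u w : U).
Local Open Scope ereal_scope.

Definition bounded_operator {V : hilbertType R} (F : U -> V) :=
  exists C : R, forall u, (`|F u| <= C * `|u|)%R.

(* For values in [0, +oo]; recall that 0 * +oo = 0 *)
Definition convex_functional J :=
  forall (u w : U) (t : R), (0 <= t <= 1)%R ->
    J (t *: u + (1 - t) *: w)%R <= t%:E * J u + (1 - t)%:E * J w.

Definition coercive J :=
  forall A : R, exists r : R, forall u, (r <= `|u|)%R -> A%:E <= J u.

Definition subdiff J u : set U :=
  [set xi | J u < +oo /\ forall w, J u + '<xi, (w - u)%R>%:E <= J w].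

(* Meaningful for xi in subdiff J u, in which case J u is finite; the value
   is +oo if J w is. *)
Definition bregman J xi w u : \bar R := J w - J u - '<xi, (w - u)%R>%:E.

Definition locally_pconvex (p : R) J :=
  forall u, subdiff J u !=set0 -> forall rho : R, (0 < rho)%R ->
  exists2 C : R, (0 < C)%R &
    forall xi w, subdiff J u xi -> (`|w - u| <= rho)%R ->
      (C * `|w - u| `^ p)%:E <= bregman J xi w u.

Definition argmin_on (D : set U) J : set U :=
  [set u | D u /\ forall w, D w -> J u <= J w].

Definition tikhonov {V : hilbertType R} (F : U -> V) J (alpha : R) (v : V) u :
    \bar R :=
  (2^-1 * `|F u - v| ^+ 2)%:E + alpha%:E * J u.

End functionals.

(* Main.v *)
Require Import Defs.
From mathcomp Require Import all_boot all_order all_algebra.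
From mathcomp Require Import all_classical all_reals all_analysis.
From mathcomp Require Import measurable_realfun ring lra.

Set Implicit Arguments.
Unset Strict Implicit.
Unset Printing Implicit Defensive.

Import Order.TTheory GRing.Theory Num.Theory.
Import numFieldNormedType.Exports.

Local Open Scope classical_set_scope.
Local Open Scope ring_scope.

(** Write [xi] for [xidag], [e] for [u - udag] and [D] for the Bregman distance.
    Comparing the value of the Tikhonov functional at its minimiser [u] with
    the value at [udag] gives
      [|F e|^2 / 4 + alpha * D <= delta^2 + alpha * <xi, - e>]
    ([tikhonov_minimiser_bound]), and by coercivity all these minimisers lie in
    one ball around [udag] ([tikhonov_minimisers_bounded]), so that local
    p-convexity bounds [|e|^p] by a multiple of [D].

    The source condition enters through the interpolation inequality
      [<(F^* F)^nu w, h> <= 2 * |w| * |F h|^(2 nu) * |h|^(1 - 2 nu)]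
    ([fractional_power_interpolation]). With [beta = (1 - 2 nu) / p], it turns
    the last term above into a multiple of [alpha * |F e|^(2 nu) * D^beta].
    Young's inequality with exponents [nu], [beta] and
    [theta = 1 - nu - beta > 0] absorbs the first two factors in the left-hand
    side; what remains is a multiple of [alpha^(1 + nu / theta)], and
    [nu / theta] is the exponent in the claim ([interpolated_rate]). The rate in
    [delta] follows by insertion of the parameter choice.

    The operator [S = (F^* F)^nu] is known only through its quadratic form
    [<S x, x> = \int t^nu d|E x|^2]. Multiplicativity of the functional
    calculus, which would give [|S h|^2 = <(F^* F)^(2 nu) h, h>], is
    therefore replaced by a direct argument. The forms of [S] and of
    [T = F^* F] split orthogonally along disjoint spectral projections
    ([spectral_form_proj_orthogonal]). On a spectral block where
    [t^nu <= c], the inequality of Cauchy and Schwarz for the nonnegative form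
    of [S], in its weighted additive version, gives
      [2 <S w, h> <= |w|^2 + c^2 |h|^2]
    ([spectral_block_young]). On a dyadic block, [c^2] is comparable with
    [t^(2 nu)], which is at most [lambda^(2 nu) + lambda^(2 nu - 1) t]; so
    summing over the dyadic blocks above a threshold [lambda] yields
    [fractional_young], and optimising [lambda] and the length of [w] yields
    the interpolation inequality. *)

(* A matrix operation of the same name hides this one. *)
Local Notation spectral_diag := Defs.spectral_diag.

(** * Nonnegative forms and spectral projections *)

Section inner_product.
Context {R : realType} {U : hilbertType R}.
Implicit Types u v w : U.

Lemma innerZr (a : R) u v : '<u, a *: v> = a * '<u, v>.
Proof. by rewrite innerC innerZl innerC. Qed.

Lemma innerNr u v : '<u, - v> = - '<u, v>.
Proof. by rewrite innerC innerNl innerC. Qed.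

Lemma normD_orthogonal u v : '<u, v> = 0 ->
  `|u + v| ^+ 2 = `|u| ^+ 2 + `|v| ^+ 2.
Proof.
move=> uv; rewrite -!inner_normE innerDl !innerDr (innerC v u) uv.
by rewrite addr0 add0r.
Qed.

(** The form of [S] is nonnegative at [u - c v]; expand. This additive version
    of the inequality of Cauchy and Schwarz can be summed over blocks, with a
    different weight [c] on each. *)
Lemma psd_form_young (S : U -> U) (c : R) u v :
  linear S -> selfadjoint S -> (forall w, 0 <= '<S w, w>) -> 0 < c ->
  2 * '<S u, v> <= c^-1 * '<S u, u> + c * '<S v, v>.
Proof.
move=> lS sS S0 c0.
have SE : S ((- c) *: v + u) = (- c) *: S v + S u by rewrite lS.
have := S0 ((- c) *: v + u); rewrite SE.
rewrite innerDl !innerDr !innerZl !innerZr (innerC _ u) -sS => h.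
rewrite -subr_ge0 -(pmulr_rge0 _ c0); apply: le_trans h _.
by rewrite le_eqVlt; apply/orP; left; apply/eqP; field; rewrite gt_eqF.
Qed.

End inner_product.

Section projection_measure.
Context {R : realType} {U : hilbertType R} (E : projMeasure U).
Implicit Types (A B : set (measurableTypeR R)) (x y : U).

Let ED A x y : measurable A -> E A (x + y) = E A x + E A y.
Proof. by move=> mA; have := pm_linear E mA 1 x y; rewrite !scale1r. Qed.

Lemma pm_orthogonal A B x y : measurable A -> measurable B ->
  A `&` B = set0 -> '<E A x, E B y> = 0.
Proof.
move=> mA mB AB0.
by rewrite pm_selfadjoint// -pm_setI// AB0 pm_set0 innerC inner0l.
Qed.

(** Finite additivity is countable additivity for [A, B, set0, set0, ...]. *)
Lemma pm_setU A B x : measurable A -> measurable B -> A `&` B = set0 ->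
  E (A `|` B) x = E A x + E B x.
Proof.
move=> mA mB AB0.
have mF i : measurable (bigcup2 A B i).
  by case: i => [//|[//|i]]; exact: measurable0.
have tF : trivIset setT (bigcup2 A B) by rewrite -trivIset_bigcup2.
have := @pm_sigma_additive _ _ E _ mF tF x; rewrite bigcup2E => h.
have h' : (fun n => \sum_(0 <= i < n) E (bigcup2 A B i) x) @ \oo
    --> E A x + E B x.
  apply: cvg_near_cst; exists 2%N => // n /= n2.
  rewrite -(subnKC n2) big_mkord !big_ord_recl/= addrA big1 ?addr0// => i _.
  by rewrite pm_set0.
exact: (cvg_unique _ h h').
Qed.

Lemma pm_setC A x : measurable A -> x = E A x + E (~` A) x.
Proof.
move=> mA; rewrite -pm_setU ?setICr//; last exact: measurableC.
by rewrite setUv pm_setT.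
Qed.

Lemma spectral_diag_proj A B x : measurable A -> measurable B ->
  spectral_diag E (E A x) B = spectral_diag E x (B `&` A).
Proof. by move=> mA mB; rewrite /spectral_diag pm_setI. Qed.

(** Pythagoras: on each Borel set [C] the two contributions are orthogonal. *)
Lemma spectral_diag_projD A B x y : measurable A -> measurable B ->
  A `&` B = set0 -> forall C, measurable C ->
  spectral_diag E (E A x + E B y) C =
  measure_add (spectral_diag E (E A x)) (spectral_diag E (E B y)) C.
Proof.
move=> mA mB AB0 C mC; rewrite measure_addE /spectral_diag ED//.
rewrite normD_orthogonal ?EFinD// -!pm_setI//.
rewrite pm_orthogonal//; try exact: measurableI.
by rewrite setIACA AB0 setI0.
Qed.

End projection_measure.

(** * The quadratic form of a spectral integral *)

Section spectral_form.
Context {R : realType} {U : hilbertType R} (E : projMeasure U).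
Context (f : R -> R) (S : U -> U) (SE : spectral_integral E f S).
Implicit Types (A B : set (measurableTypeR R)) (x y : U) (c : R).

Let lS : linear S. Proof. by case: SE. Qed.

Let SD x y : S (x + y) = S x + S y.
Proof. by have := lS 1 x y; rewrite !scale1r. Qed.

Let intf x : (spectral_diag E x).-integrable setT (EFin \o f).
Proof. by case: SE => _ _ /(_ x) []. Qed.

Let formE x : (\int[spectral_diag E x]_t (f t)%:E)%E = '<S x, x>%:E.
Proof. by case: SE => _ _ /(_ x) []. Qed.

(** The spectral measure of [E A x] does not charge the complement of [A]. *)
Lemma spectral_form_projE A x : measurable A ->
  '<S (E A x), E A x>%:E = (\int[spectral_diag E (E A x)]_(t in A) (f t)%:E)%E.
Proof.
move=> mA; rewrite -formE (@negligible_integral _ _ _ _ setT (~` A))//.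
- by rewrite setTD setCK.
- exact: measurableC.
- exact: intf.
- rewrite [LHS](spectral_diag_proj E x mA (measurableC mA)).
  by rewrite setICl measure0.
Qed.

Let int_cst A x c : measurable A ->
  (spectral_diag E x).-integrable A (EFin \o cst c).
Proof.
move=> mA; apply/integrableP; split.
  by apply/measurable_EFinP; exact: measurable_cst.
rewrite [X in (X < _)%E](_ : _ = (`|c|%:E * spectral_diag E x A)%E) ?ltry//.
by rewrite -integral_cst.
Qed.

Let cstE A x c : measurable A ->
  (\int[spectral_diag E (E A x)]_(t in A) (EFin \o cst c) t)%E
    = (c * `|E A x| ^+ 2)%:E.
Proof.
move=> mA; transitivity (c%:E * spectral_diag E (E A x) A)%E.
  by rewrite -integral_cst.
by rewrite /spectral_diag -pm_setI// setIid.
Qed.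

Lemma spectral_form_le A x c : measurable A -> (forall t, A t -> f t <= c) ->
  '<S (E A x), E A x> <= c * `|E A x| ^+ 2.
Proof.
move=> mA fc; rewrite -lee_fin spectral_form_projE// -cstE//.
apply: le_integral => //; last by move=> t /set_mem At; rewrite lee_fin fc.
  by apply: integrableS (intf _).
exact: int_cst.
Qed.

Lemma spectral_form_ge A x c : measurable A -> (forall t, A t -> c <= f t) ->
  c * `|E A x| ^+ 2 <= '<S (E A x), E A x>.
Proof.
move=> mA fc; rewrite -lee_fin spectral_form_projE// -cstE//.
apply: le_integral => //; last by move=> t /set_mem At; rewrite lee_fin fc.
  exact: int_cst.
by apply: integrableS (intf _).
Qed.

Lemma spectral_form_projD A B x y : measurable A -> measurable B ->
  A `&` B = set0 ->
  '<S (E A x + E B y), E A x + E B y> =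
  '<S (E A x), E A x> + '<S (E B y), E B y>.
Proof.
move=> mA mB AB0; apply: EFin_inj; rewrite EFinD -!formE.
rewrite -integral_measure_add//; try exact: intf.
apply: eq_measure_integral => C mC _.
exact: spectral_diag_projD.
Qed.

(** A symmetric form that is additive at [E A x + E B y] has no cross term
    there. This is how commutation of [S] with the projections is used. *)
Lemma spectral_form_proj_orthogonal A B x y : measurable A -> measurable B ->
  A `&` B = set0 -> '<S (E A x), E B y> = 0.
Proof.
move=> mA mB AB0; have := spectral_form_projD x y mA mB AB0.
have [_ sS _] := SE.
rewrite SD innerDl !innerDr (sS (E B y)) (innerC (E B y)).
set a := '<S (E A x), E A x>; set b := '<S (E A x), E B y>.
move: ('<E B y, S (E B y)>) => c; lra.
Qed.

Lemma spectral_form_projr A x y : measurable A ->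
  '<S x, E A y> = '<S (E A x), E A y>.
Proof.
move=> mA; rewrite {1}(pm_setC E x mA) SD innerDl.
rewrite (spectral_form_proj_orthogonal x y (measurableC mA) mA) ?addr0//.
exact: setICl.
Qed.

End spectral_form.

(** * Where the spectral measure of a bounded nonnegative operator lives *)

Section null_sets.
Context {R : realType} {U : hilbertType R} (E : projMeasure U).
Context (T : U -> U) (TE : spectral_integral E id T).

(** On vectors of the form [E N x], [N] the negative half-line, the form of
    [T] is both nonnegative and the integral of a negative function. As
    [powR] is 1 at negative reals, no bound of [t^nu] by a small constant could
    hold on a set that contains some of them. *)
Lemma spectral_null_neg : (forall x, 0 <= '<T x, x>) ->
  forall x, E `]-oo, 0[%classic x = 0.
Proof.
move=> T0 x; set N := (X in E X).
have mN : measurable (N : set (measurableTypeR R)) by exact: measurable_itv.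
pose mu : {measure set (measurableTypeR R) -> \bar R} :=
  spectral_diag E (E N x).
have iN : mu.-integrable N (EFin \o id).
  by case: TE => _ _ /(_ (E N x)) [+ _]; apply: integrableS.
have I0 : (\int[mu]_(t in N) `|(t : R)%:E| = 0)%E.
  apply/eqP; rewrite eq_le; apply/andP; split; last exact: integral_ge0.
  have -> : (\int[mu]_(t in N) `|(t : R)%:E| =
             \int[mu]_(t in N) ((-1)%:E * (t : R)%:E))%E.
    apply: eq_integral; move=> t; rewrite inE /N /= in_itv /= => t0.
    by rewrite -EFinM mulN1r /= ltr0_norm.
  rewrite integralZl// -(spectral_form_projE TE)// -EFinM lee_fin.
  by rewrite mulN1r oppr_le0.
have /(ae_eq_integral_abs mu mN (measurable_int _ iN)) aeN := I0.
have : mu N = 0%E.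
  apply/(measure_negligible mN); apply: negligibleS aeN => t Nt /= /(_ Nt).
  by move: Nt; rewrite /N /= in_itv /= => /[swap] -[->]; rewrite ltxx.
rewrite /mu/= /Defs.spectral_diag -pm_setI// setIid => -[/eqP].
by rewrite expf_eq0/= normr_eq0 => /eqP.
Qed.

Lemma spectral_null_top (C K : R) : (forall x, '<T x, x> <= C * `|x| ^+ 2) ->
  C < K -> forall x, E `[K, +oo[%classic x = 0.
Proof.
move=> TC CK x; set N := (X in E X).
have mN : measurable (N : set (measurableTypeR R)) by exact: measurable_itv.
have : K * `|E N x| ^+ 2 <= C * `|E N x| ^+ 2.
  apply: le_trans (TC _); apply: (spectral_form_ge TE) => // t.
  by rewrite /N /= in_itv /= andbT.
rewrite -subr_ge0 -mulrBl nmulr_rge0 ?subr_lt0// => n0.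
by apply/eqP; rewrite -normr_eq0 -sqrf_eq0 eq_le n0 exprn_ge0.
Qed.

End null_sets.

(** * Interpolation for fractional powers *)

Section interpolation.
Context {R : realType} {U : hilbertType R} (E : projMeasure U).
Context (T : U -> U) (TE : spectral_integral E id T).
Context (nu : R) (hnu : 0 < nu < 2^-1).
Context (S : U -> U) (SE : spectral_integral E (fun t => t `^ nu) S).
Implicit Types (A B : set (measurableTypeR R)) (w h : U) (lambda : R).

Let nu0 : 0 < nu. Proof. by case/andP: hnu. Qed.

Let S_ge0 w : 0 <= '<S w, w>.
Proof.
rewrite -{1 2}(pm_setT E w).
have := @spectral_form_ge _ _ _ _ _ SE setT w 0 measurableT.
by rewrite mul0r; apply=> t _; exact: powR_ge0.
Qed.

(** [psd_form_young] with weight [c] for the block components of [w] and [h]: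
    the form of [S] at these is at most [c] times the squared norm, hence the
    coefficients [1] and [c^2]. *)
Lemma spectral_block_young A w h c : measurable A -> 0 < c ->
  (forall t, A t -> t `^ nu <= c) ->
  2 * '<S w, E A h> <= `|E A w| ^+ 2 + c ^+ 2 * `|E A h| ^+ 2.
Proof.
move=> mA c0 fc; rewrite (spectral_form_projr SE)//.
have [lS sS _] := SE.
apply: le_trans (psd_form_young (E A w) (E A h) lS sS S_ge0 c0) _.
apply: lerD.
  by rewrite mulrC ler_pdivrMr// mulrC (spectral_form_le SE).
by rewrite expr2 -mulrA ler_pM2l// (spectral_form_le SE).
Qed.

(** The estimate restricted to a block. The right-hand side represents
    [|w|^2] plus the integral of
    [2 * lambda^(2 nu - 1) * (lambda + t)], an upper bound of [t^(2 nu)] that is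
    affine in [t] and hence expressible by [T]. *)
Let young lambda w h A := 2 * '<S w, E A h> <= `|E A w| ^+ 2 +
  2 * lambda `^ (2 * nu - 1) *
    (lambda * `|E A h| ^+ 2 + '<T (E A h), E A h>).

Let youngU lambda w h A B : measurable A -> measurable B -> A `&` B = set0 ->
  young lambda w h A -> young lambda w h B -> young lambda w h (A `|` B).
Proof.
move=> mA mB AB0; rewrite /young !pm_setU// innerDr.
rewrite (spectral_form_projD TE)// !normD_orthogonal ?(pm_orthogonal E)//.
set k := 2 * lambda `^ _; move: (k) => {}k; lra.
Qed.

Let half_open (a b : R) :
  measurable (`[a, b[%classic : set (measurableTypeR R)).
Proof. exact: measurable_itv. Qed.

Let young_dyadic lambda w h n : 0 < lambda ->
  young lambda w h `[0, 2 ^+ n * lambda[%classic.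
Proof.
move=> l0; have lE : lambda `^ (2 * nu - 1) * lambda = lambda `^ (2 * nu).
  by rewrite mulrC mulr_powRB1 ?ltW// mulr_gt0.
(* Base block [0, lambda[ with c = lambda^nu; each further block doubles the
   upper end, with c = (2^(n+1) lambda)^nu. *)
elim: n => [|n IH].
  apply: le_trans (@spectral_block_young _ w h (lambda `^ nu) _ _ _) _ => //.
  - exact: powR_gt0.
  - move=> t /=; rewrite in_itv/= mul1r => /andP[t0 tl].
    by rewrite ge0_ler_powR ?nnegrE// ?ltW.
  rewrite lerD2l -mulrA mulrDr mulrA lE -(powR_mulrn 2 (powR_ge0 _ nu)) -powRrM.
  rewrite (mulrC nu).
  set A := (X in E X); have T0 : 0 <= '<T (E A h), E A h>.
    have := @spectral_form_ge _ _ _ _ _ TE A h 0 (half_open _ _).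
    by rewrite mul0r; apply=> t; rewrite /A /= in_itv/= => /andP[].
  have := powR_ge0 lambda (2 * nu - 1); have := powR_ge0 lambda (2 * nu).
  have := exprn_ge0 2 (normr_ge0 (E A h)); nra.
have m1 : 1 <= 2 ^+ n :> R by rewrite exprn_ege1// ler1n.
have -> : `[0, 2 ^+ n.+1 * lambda[%classic =
    `[0, 2 ^+ n * lambda[%classic `|`
    `[2 ^+ n * lambda, 2 ^+ n.+1 * lambda[%classic :> set R.
  apply/seteqP; split=> t /=; rewrite !in_itv/= exprS.
    by move=> /andP[-> ->]/=; case: ltP; [left|right].
  by move=> [|] /andP[? ?]; apply/andP; split; nra.
apply: youngU => //.
  apply/seteqP; split=> t //= []; rewrite !in_itv/= => /andP[_ +] /andP[+ _].
  by move=> /lt_le_trans /[apply]; rewrite ltxx.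
set A := (X in young _ _ _ X).
have mA : measurable (A : set (measurableTypeR R)) by exact: half_open.
apply: le_trans
  (@spectral_block_young A w h ((2 ^+ n.+1 * lambda) `^ nu) _ _ _) _ => //.
- by rewrite powR_gt0// mulr_gt0// exprn_gt0.
- move=> t; rewrite /A /= in_itv/= => /andP[t0 tl].
  have tp : 0 <= t by apply: le_trans t0; rewrite mulr_ge0 ?exprn_ge0 ?ltW.
  by rewrite ge0_ler_powR ?nnegrE// ?ltW// mulr_gt0// exprn_gt0.
rewrite lerD2l -(powR_mulrn 2 (powR_ge0 _ nu)) -powRrM (mulrC nu).
rewrite powRM ?exprn_ge0 ?(ltW l0)//.
have TA : 2 ^+ n * lambda * `|E A h| ^+ 2 <= '<T (E A h), E A h>.
  by apply: (spectral_form_ge TE) => // t; rewrite /A /= in_itv/= => /andP[].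
have pw : (2 ^+ n.+1) `^ (2 * nu) <= 2 ^+ n.+1 :> R.
  rewrite ler1_powR//; last by move: hnu; lra.
  by rewrite exprn_ege1// ler1n.
have e0 := exprn_ge0 2 (normr_ge0 (E A h)).
apply: (@le_trans _ _ (2 * lambda `^ (2 * nu - 1) *
    (2 ^+ n * lambda * `|E A h| ^+ 2))).
  have -> : 2 * lambda `^ (2 * nu - 1) * (2 ^+ n * lambda * `|E A h| ^+ 2) =
    2 ^+ n.+1 * lambda `^ (2 * nu) * `|E A h| ^+ 2.
    by rewrite -lE (exprS 2 n); ring.
  by rewrite ler_wpM2r// ler_wpM2r// powR_ge0.
rewrite ler_wpM2l ?mulr_ge0 ?powR_ge0//.
apply: le_trans TA _; rewrite lerDr mulr_ge0// ltW//.
Qed.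

(** The spectrum of [T] lies in [[0, C]], so finitely many dyadic blocks
    suffice. *)
Lemma fractional_young (C lambda : R) w h :
  (forall x, 0 <= '<T x, x> <= C * `|x| ^+ 2) -> 0 < lambda ->
  2 * '<S w, h> <= `|w| ^+ 2 +
    2 * lambda `^ (2 * nu - 1) * (lambda * `|h| ^+ 2 + '<T h, h>).
Proof.
move=> hT l0.
have [n nC] : exists n, C < 2 ^+ n * lambda.
  exists (Num.bound (C / lambda)); rewrite -ltr_pdivrMr//.
  exact: upper_nthrootP.
have EI x : E `[0, 2 ^+ n * lambda[%classic x = x.
  have k0 : 0 <= 2 ^+ n * lambda by rewrite mulr_ge0 ?exprn_ge0 ?ltW.
  rewrite -[RHS](pm_setT E) (_ : setT = `]-oo, 0[%classic `|`
    (`[0, 2 ^+ n * lambda[%classic `|` `[2 ^+ n * lambda, +oo[%classic));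
    last first.
    apply/seteqP; split=> t //= _; rewrite !in_itv/= andbT.
    case: ltP => t0; first by left.
    by right; case: ltP => ?; [left|right].
  rewrite !pm_setU//.
  - rewrite (spectral_null_neg TE) ?add0r; last by move=> y; case/andP: (hT y).
    rewrite (spectral_null_top TE _ nC) ?addr0//.
    by move=> y; case/andP: (hT y).
  - apply/seteqP; split=> t //= []; rewrite !in_itv/= => /andP[_ +] /andP[+ _].
    by move=> /lt_le_trans /[apply]; rewrite ltxx.
  - by apply: measurableU => //; exact: measurable_itv.
  - apply/seteqP; split=> t //=; rewrite !in_itv/= andbT => -[t0 [/andP[]|]].
      by move=> /le_lt_trans /(_ t0); rewrite ltxx.
    by move=> /(le_trans k0) /le_lt_trans /(_ t0); rewrite ltxx.
by have := young_dyadic w h n l0; rewrite /young !EI.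
Qed.

End interpolation.

Section fractional_interpolation.
Context {R : realType} {U V : hilbertType R} (F : {linear U -> V}).
Context (hF : bounded_operator F) (nu : R) (hnu : 0 < nu < 2^-1).
Implicit Types (w h x : U).

(** For a true adjoint the upper bound is an equality; the other case is the
    default value of [adjoint]. *)
Let adjoint_form x : 0 <= '<(adjoint F \o F) x, x> <= `|F x| ^+ 2.
Proof.
rewrite /adjoint /=; case: xgetP => [G _ FG|_]; last first.
  by rewrite inner0l lexx exprn_ge0.
by rewrite innerC -FG inner_normE exprn_ge0/=.
Qed.

(** Homogeneity: apply [fractional_young] to [s *: w] and choose [s] and
    [lambda] such that the terms on the right balance. The default
    value 0 of the spectral calculus satisfies the bound trivially. *)
Lemma fractional_power_interpolation w h :
  '<fractional_power (adjoint F \o F) nu w, h> <=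
  2 * `|w| * (`|F h| `^ (2 * nu) * `|h| `^ (1 - 2 * nu)).
Proof.
have nu0 : 0 < nu by case/andP: hnu.
rewrite /fractional_power /spectral_calculus.
case: xgetP => [S _ [E TE SE]|_]; last first.
  by rewrite inner0l !mulr_ge0 ?powR_ge0.
have [C hC] := hF.
have hT x : 0 <= '<(adjoint F \o F) x, x> <= C ^+ 2 * `|x| ^+ 2.
  have /andP[-> h2] := adjoint_form x.
  rewrite (le_trans h2)// -exprMn ler_sqr ?nnegrE//.
  exact: le_trans (hC x).
have [lS _ _] := SE.
have S0 : S 0 = 0.
  by have := lS (-1) 0 0; rewrite scaler0 addr0 scaleN1r addNr.
have SZ a : S (a *: w) = a *: S w by have := lS a w 0; rewrite S0 !addr0.
have [w0|w0] := eqVneq w 0.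
  by rewrite w0 S0 inner0l !mulr_ge0 ?powR_ge0.
have b0 : 0 < `|w| by rewrite normr_gt0.
set y := '<S w, h>; set b := `|w| in b0 *; set X := `|F h|; set H := `|h|.
have X0 : 0 <= X by exact: normr_ge0.
have H0 : 0 <= H by exact: normr_ge0.
have young s lambda : 0 < lambda ->
    2 * (s * y) <= s ^+ 2 * b ^+ 2 +
      2 * lambda `^ (2 * nu - 1) * (lambda * H ^+ 2 + X ^+ 2).
  move=> l0; have := fractional_young TE hnu SE (s *: w) h hT l0.
  rewrite SZ innerZl normrZ exprMn real_normK ?num_real// => /le_trans; apply.
  rewrite lerD2l ler_wpM2l ?mulr_ge0 ?powR_ge0// lerD2l.
  by case/andP: (adjoint_form h).
have [Xz|Xn] := eqVneq X 0.
  (* Here the right-hand side of young is s^2 b^2 + 2 lambda^(2 nu) H^2. If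
     y > 0, it is too small for s = y / b^2 and lambda^(2 nu) = eps. *)
  rewrite Xz powR0 ?mul0r ?mulr0; last by rewrite mulf_neq0 ?pnatr_eq0// gt_eqF.
  rewrite leNgt; apply/negP => y0.
  pose eps := y ^+ 2 / (4 * b ^+ 2 * (H ^+ 2 + 1)).
  have d0 : 0 < 4 * b ^+ 2 * (H ^+ 2 + 1).
    by rewrite !mulr_gt0 ?exprn_gt0// ltr_pwDr// exprn_ge0.
  have eps0 : 0 < eps by rewrite divr_gt0 ?exprn_gt0.
  have l0 : 0 < eps `^ (2 * nu)^-1 by rewrite powR_gt0.
  have := young (y / b ^+ 2) _ l0; move: l0; set lam := _ `^ _ => l0.
  have lamE : lam `^ (2 * nu - 1) * lam = eps.
    rewrite mulrC mulr_powRB1 ?(ltW l0) ?mulr_gt0// -powRrM.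
    by rewrite mulVf ?powRr1 ?(ltW eps0)// mulf_neq0 ?pnatr_eq0 ?gt_eqF.
  have -> : 2 * lam `^ (2 * nu - 1) * (lam * H ^+ 2 + X ^+ 2)
      = 2 * eps * H ^+ 2 by rewrite Xz expr0n /= -lamE; ring.
  have -> : (y / b ^+ 2) ^+ 2 * b ^+ 2 = y ^+ 2 / b ^+ 2.
    by field; rewrite gt_eqF.
  have -> : 2 * (y / b ^+ 2 * y) = 2 * (y ^+ 2 / b ^+ 2) by ring.
  have epsE : eps * (H ^+ 2 + 1) * 4 = y ^+ 2 / b ^+ 2.
    rewrite /eps; field; rewrite (gt_eqF b0)/=.
    by rewrite gt_eqF// ltr_pwDr// exprn_ge0.
  rewrite -epsE; have := exprn_ge0 2 H0; nra.
have Xp : 0 < X by rewrite lt_neqAle eq_sym Xn.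
have Hp : 0 < H.
  rewrite /H normr_gt0; apply: contraNneq Xn => h0.
  by rewrite /X h0 linear0 normr0.
set g := X `^ (2 * nu) * H `^ (1 - 2 * nu).
have g0 : 0 < g by rewrite mulr_gt0// powR_gt0.
(* lambda = X^2 / H^2 balances the two terms in the bracket, and s = 2 g / b
   balances these with the norm of s *: w. *)
have l0 : 0 < (X / H) ^+ 2 by rewrite exprn_gt0// divr_gt0.
have := young (2 * g / b) _ l0.
have -> : 2 * ((X / H) ^+ 2) `^ (2 * nu - 1) * ((X / H) ^+ 2 * H ^+ 2 + X ^+ 2)
    = 4 * g ^+ 2.
  have -> : (X / H) ^+ 2 * H ^+ 2 = X ^+ 2 by field; rewrite gt_eqF.
  have -> : ((X / H) ^+ 2) `^ (2 * nu - 1) =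
      (X `^ (2 * nu) / X) ^+ 2 * (H `^ (1 - 2 * nu)) ^+ 2.
    rewrite -[(X / H) ^+ 2]powR_mulrn ?(divr_ge0 X0 H0)// powRAC.
    rewrite powR_mulrn ?powR_ge0//.
    rewrite -exprMn; congr (_ ^+ 2).
    rewrite powRM ?invr_ge0//; congr (_ * _).
      by rewrite powRB ?powRr1//; apply/implyP.
    by rewrite -powR_inv1// -powRrM; congr (_ `^ _); ring.
  by rewrite /g; field; rewrite gt_eqF.
have -> : (2 * g / b) ^+ 2 * b ^+ 2 = 4 * g ^+ 2 by field; rewrite gt_eqF.
have -> : 2 * (2 * g / b * y) = 4 * g * (y / b) by field; rewrite gt_eqF.
have -> : 4 * g ^+ 2 + 4 * g ^+ 2 = 4 * g * (2 * g) by ring.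
have g40 : 0 < 4 * g by rewrite mulr_gt0.
rewrite (ler_pM2l g40) (ler_pdivrMr _ _ b0) => /le_trans; apply.
by rewrite mulrAC.
Qed.

End fractional_interpolation.

(** * From interpolation to a rate *)

(** Each of the three numbers is at most their sum [m], and
    [m^x m^y m^z = m]. *)
Lemma powR3_le_add (R : realType) (a b c x y z : R) : 0 <= a -> 0 <= b ->
  0 <= c -> 0 < x -> 0 < y -> 0 < z -> x + y + z = 1 ->
  a `^ x * b `^ y * c `^ z <= a + b + c.
Proof.
move=> a0 b0 c0 x0 y0 z0 xyz; set m := a + b + c.
have m0 : 0 <= m by rewrite !addr_ge0.
have -> : m = m `^ x * m `^ y * m `^ z.
  rewrite -!powRD ?xyz ?powRr1//; apply/implyP; rewrite ?oner_eq0//.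
  by rewrite gt_eqF// addr_gt0.
have pm t s : 0 <= t -> t <= m -> 0 < s -> t `^ s <= m `^ s.
  by move=> *; rewrite ge0_ler_powR ?nnegrE// ltW.
rewrite !ler_pM ?mulr_ge0 ?powR_ge0 ?pm// /m.
- by rewrite -addrA lerDl addr_ge0.
- by rewrite addrAC lerDr addr_ge0.
- by rewrite lerDr addr_ge0.
Qed.

(** [K] is the constant of the source condition, [c] that of local p-convexity,
    [X] and [e] stand for the norms of [F (u - udag)] and of [u - udag]. The
    last two hypotheses combine through [powR3_le_add] for [X^2 / 4],
    [alpha D / 2] and a power of [alpha]. *)
Lemma interpolated_rate (R : realType) (p nu K c : R) :
  1 <= p -> 0 < nu < 2^-1 -> 0 < K -> 0 < c ->
  exists2 L : R, 0 < L & forall alpha delta X D e : R,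
    0 < alpha -> 0 <= X -> 0 <= e -> c * e `^ p <= D ->
    X ^+ 2 / 4 + alpha * D <=
      delta ^+ 2 + alpha * (K * (X `^ (2 * nu) * e `^ (1 - 2 * nu))) ->
    D <= 2 * (delta ^+ 2 / alpha) +
         L * alpha `^ (nu * p / (p - 1 - p * nu + 2 * nu)).
Proof.
move=> p1 /andP[nu0 nu2] K0 c0.
have p0 : 0 < p by lra.
pose beta := (1 - 2 * nu) / p; pose theta := 1 - nu - beta.
have b0 : 0 < beta by rewrite divr_gt0//; lra.
have thE : theta = (p - 1 - p * nu + 2 * nu) / p.
  by rewrite /theta /beta; field; rewrite gt_eqF.
have q0 : 0 < p - 1 - p * nu + 2 * nu by nra.
have t0 : 0 < theta by rewrite thE divr_gt0.
(* K' collects the constants; L makes the third factor of the product carry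
   exactly K'. *)
pose K' := K * 4 `^ nu * 2 `^ beta * c^-1 `^ beta.
have K'0 : 0 < K' by rewrite !mulr_gt0 ?powR_gt0 ?invr_gt0.
pose L := K' `^ theta^-1.
have L0 : 0 < L by rewrite powR_gt0.
exists (2 * L); first by rewrite mulr_gt0.
move=> alpha delta X D e a0 X0 e0 eD main.
have D0 : 0 <= D by apply: le_trans eD; rewrite mulr_ge0 ?powR_ge0// ltW.
have eb : e `^ (1 - 2 * nu) <= c^-1 `^ beta * D `^ beta.
  have -> : 1 - 2 * nu = p * beta by rewrite /beta; field; rewrite gt_eqF.
  rewrite powRrM -powRM ?invr_ge0 ?(ltW c0)//.
  rewrite ge0_ler_powR ?nnegrE ?(ltW b0) ?powR_ge0//.
    by rewrite mulr_ge0 ?invr_ge0// ltW.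
  by rewrite mulrC ler_pdivlMr// mulrC.
have aD0 : 0 <= alpha * D by rewrite mulr_ge0// ltW.
have := @powR3_le_add _ (X ^+ 2 / 4) (alpha * D / 2)
  (L * alpha `^ ((1 - beta) / theta)) nu beta theta.
rewrite divr_ge0 ?exprn_ge0// divr_ge0// mulr_ge0 ?powR_ge0 ?(ltW L0)//.
move=> /(_ isT isT isT nu0 b0 t0); rewrite {1}/theta => young.
have {}young := young ltac:(by ring).
have prodE : (X ^+ 2 / 4) `^ nu * (alpha * D / 2) `^ beta *
    (L * alpha `^ ((1 - beta) / theta)) `^ theta =
    alpha * (K * (X `^ (2 * nu) * (c^-1 `^ beta * D `^ beta))).
  rewrite -(powR_mulrn 2 X0) !powRM ?invr_ge0 ?powR_ge0 ?(ltW a0) ?(ltW L0)//.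
  rewrite -!powRrM mulVf ?gt_eqF// powRr1 ?(ltW K'0)//.
  rewrite divfK ?gt_eqF//.
  have -> : 4^-1 `^ nu = (4 `^ nu)^-1 :> R.
    by rewrite -powR_inv1// -powRrM mulN1r powRN.
  have -> : 2^-1 `^ beta = (2 `^ beta)^-1 :> R.
    by rewrite -powR_inv1// -powRrM mulN1r powRN.
  have -> : alpha `^ (1 - beta) = alpha / alpha `^ beta.
    by rewrite powRB ?powRr1 ?(ltW a0)//; apply/implyP => _; rewrite gt_eqF.
  rewrite /K'; field.
  by rewrite !gt_eqF ?powR_gt0.
have step : alpha * (K * (X `^ (2 * nu) * e `^ (1 - 2 * nu))) <=
    X ^+ 2 / 4 + alpha * D / 2 + L * alpha `^ ((1 - beta) / theta).
  apply: le_trans young; rewrite prodE.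
  by rewrite !ler_wpM2l ?powR_ge0 ?(ltW a0) ?(ltW K0).
have aE : alpha `^ ((1 - beta) / theta) =
    alpha * alpha `^ (nu * p / (p - 1 - p * nu + 2 * nu)).
  rewrite -{2}(powRr1 (ltW a0)) -powRD; last first.
    by apply/implyP => _; rewrite gt_eqF.
  congr (_ `^ _); rewrite thE /beta; field.
  by rewrite !gt_eqF.
rewrite -(ler_pM2l a0) mulrDr.
have -> : alpha * (2 * (delta ^+ 2 / alpha)) = 2 * delta ^+ 2.
  by field; rewrite gt_eqF.
move: step; rewrite aE; set W := alpha `^ (nu * p / _).
have -> : alpha * (2 * L * W) = 2 * (L * (alpha * W)) by ring.
lra.
Qed.

(** * Tikhonov minimisers *)

(** Minimality against [udag], subtracting the subgradient term on both sides.
    The factor 1/4 comes from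
    [|F (udag - u)|^2 <= 2 |F udag - vdelta|^2 + 2 |F u - vdelta|^2]. *)
Lemma tikhonov_minimiser_bound (R : realType) (U V : hilbertType R)
    (F : {linear U -> V}) (J : U -> \bar R) (udag : U) (j0 : R)
    (alpha delta : R) (vdelta : V) (xi u : U) :
  (forall w, (0 <= J w)%E) -> J udag = j0%:E -> 0 < alpha ->
  `|vdelta - F udag| <= delta ->
  argmin_on setT (tikhonov F J alpha vdelta) u ->
  exists j : R, [/\ J u = j%:E, j <= 2^-1 * (delta ^+ 2 / alpha) + j0 &
    `|F (udag - u)| ^+ 2 / 4 + alpha * (j - j0 - '<xi, u - udag>) <=
      delta ^+ 2 + alpha * '<xi, udag - u> ].
Proof.
move=> J0 Jdag a0 vd [_ /(_ udag I)]; rewrite /tikhonov Jdag.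
case: (J u) (J0 u) => [j _| |]; last 2 first.
- by move=> _; rewrite gt0_muley ?lte_fin// addey// leye_eq.
- by rewrite leNgt ltNy0.
have d0 : 0 <= delta by exact: le_trans (normr_ge0 _) vd.
have dE : `|F udag - vdelta| ^+ 2 <= delta ^+ 2.
  by rewrite distrC ler_sqr ?nnegrE ?normr_ge0.
rewrite -!EFinM -!EFinD lee_fin => opt; exists j; split=> //.
  rewrite -(ler_pM2l a0) mulrDr.
  have -> : alpha * (2^-1 * (delta ^+ 2 / alpha)) = 2^-1 * delta ^+ 2.
    by field; rewrite gt_eqF.
  have := exprn_ge0 2 (normr_ge0 (F u - vdelta)).
  move: dE; lra.
have -> : '<xi, u - udag> = - '<xi, udag - u> by rewrite -innerNr opprB.
set s := '<xi, udag - u>.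
have tri : `|F (udag - u)| <= `|F udag - vdelta| + `|F u - vdelta|.
  by rewrite linearB (distrC (F u)) (le_trans _ (ler_normD _ _))// subrKA.
have := normr_ge0 (F (udag - u)); move: tri opt dE.
move: `|F (udag - u)| `|F udag - vdelta| `|F u - vdelta| => x y z tri opt dE x0.
have xyz : x ^+ 2 <= 2 * (y ^+ 2 + z ^+ 2).
  have : x ^+ 2 <= (y + z) ^+ 2 by rewrite ler_sqr ?nnegrE// (le_trans x0).
  have := sqr_ge0 (y - z); lra.
lra.
Qed.

(** Local p-convexity has a constant for each radius; a radius common to all
    admissible minimisers makes the final constants uniform. *)
Lemma tikhonov_minimisers_bounded (R : realType) (U V : hilbertType R)
    (F : {linear U -> V}) (J : U -> \bar R) (udag : U) (M : R) :
  (forall w, (0 <= J w)%E) -> coercive J -> (J udag < +oo)%E ->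
  exists2 rho : R, 0 < rho & forall (delta alpha : R) (vdelta : V) (u : U),
    0 < alpha -> delta ^+ 2 / alpha <= M -> `|vdelta - F udag| <= delta ->
    argmin_on setT (tikhonov F J alpha vdelta) u -> `|u - udag| <= rho.
Proof.
move=> J0 Jcoer; case Jdag : (J udag) (J0 udag) => [j0| |]// _ _.
have [r Jr] := Jcoer (2^-1 * M + j0 + 1).
exists (`|r| + `|udag| + 1); first by rewrite ltr_pwDr// addr_ge0.
move=> delta alpha vdelta u a0 dM vd min_u.
have [j [Ju jle _]] := tikhonov_minimiser_bound 0 J0 Jdag a0 vd min_u.
have ur : `|u| < r.
  by rewrite ltNge; apply/negP => /Jr; rewrite Ju lee_fin; lra.
rewrite (le_trans (ler_normB _ _))//; have := ler_norm r; lra.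
Qed.

Theorem theorem10 (R : realType) (U V : hilbertType R)
    (F : {linear U -> V}) (hF : bounded_operator F)
    (J : U -> \bar R) (J_ge0 : forall u, (0 <= J u)%E)
    (J_convex : convex_functional J) (J_lsc : lower_semicontinuous J)
    (J_coercive : coercive J)
    (vdag : V) (udag : U) (hudag : argmin_on [set u | F u = vdag] J udag)
    (p : R) (hp : 1 <= p) (J_pconvex : locally_pconvex p J)
    (nu : R) (hnu : 0 < nu < 2^-1)
    (omegadag xidag : U)
    (hxi : xidag = fractional_power (adjoint F \o F) nu omegadag)
    (hsub : subdiff J udag xidag) :
  (forall M : R, 0 < M ->
    exists C1 C2 : R, [/\ 0 < C1, 0 < C2 &
      forall (delta alpha : R) (vdelta : V) (u : U),
        0 < delta -> 0 < alpha -> delta ^+ 2 / alpha <= M ->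
        `|vdelta - vdag| <= delta ->
        argmin_on setT (tikhonov F J alpha vdelta) u ->
        (bregman J xidag u udag <=
          (C1 * (delta ^+ 2 / alpha) +
           C2 * alpha `^ (nu * p / (p - 1 - p * nu + 2 * nu)))%:E)%E])
  /\
  (let a := (2 * p - 2 - 2 * p * nu + 4 * nu) / (p - 1 + 2 * nu) in
   forall c c' : R, 0 < c -> c <= c' ->
    exists delta0 C : R, [/\ 0 < delta0, 0 < C &
      forall (delta alpha : R) (vdelta : V) (u : U),
        0 < delta -> delta <= delta0 ->
        c * delta `^ a <= alpha -> alpha <= c' * delta `^ a ->
        `|vdelta - vdag| <= delta ->
        argmin_on setT (tikhonov F J alpha vdelta) u ->
        (bregman J xidag u udag <=
          (C * delta `^ (2 * nu * p / (p - 1 + 2 * nu)))%:E)%E]).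
Proof.
have Fudag : F udag = vdag by case: hudag.
have Jdag_fin : (J udag < +oo)%E by case: hsub.
have conj_dep (A B : Prop) : A -> (A -> B) -> A /\ B.
  by move=> a h; exact: conj a (h a).
refine (conj_dep _ _ _ _) => [M M0|rate a c c' c0 cc'].
  have [rho rho0 bounded] :=
    tikhonov_minimisers_bounded F M J_ge0 J_coercive Jdag_fin.
  have subne : subdiff J udag !=set0 by exists xidag.
  have [c c0 pconv] := J_pconvex udag subne rho rho0.
  (* The summand 1 keeps K positive when omegadag = 0. *)
  have K0 : 0 < 2 * `|omegadag| + 1 by rewrite ltr_pwDr// mulr_ge0.
  have [L L0 young] := interpolated_rate hp hnu K0 c0.
  exists 2, L; split=> // delta alpha vdelta u d0 a0 dM vd min_u.
  rewrite -Fudag in vd.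
  case Jdag : (J udag) (J_ge0 udag) Jdag_fin => [j0| |]// _ _.
  have [j [Ju _ opt]] := tikhonov_minimiser_bound xidag J_ge0 Jdag a0 vd min_u.
  have := pconv _ _ hsub (bounded _ _ _ _ a0 dM vd min_u).
  rewrite /bregman Ju Jdag -!EFinB !lee_fin distrC => pc.
  apply: (young alpha delta `|F (udag - u)| _ `|udag - u|) => //.
  apply: le_trans opt _; rewrite lerD2l (ler_pM2l a0) hxi.
  apply: le_trans (fractional_power_interpolation hF hnu _ _) _.
  by rewrite ler_wpM2r ?mulr_ge0 ?powR_ge0// lerDl.
have [nu0 nu2] : 0 < nu /\ nu < 2^-1 by apply/andP.
set r := 2 * nu * p / (p - 1 + 2 * nu).
have q0 : 0 < p - 1 + 2 * nu by lra.
have t0 : 0 < p - 1 - p * nu + 2 * nu by nra.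
have c'0 : 0 < c' by apply: lt_le_trans cc'.
have e0 : 0 <= nu * p / (p - 1 - p * nu + 2 * nu).
  by rewrite ltW// divr_gt0// mulr_gt0//; lra.
have [C1 [C2 [C10 C20 est]]] := rate c^-1 ltac:(by rewrite invr_gt0).
exists 1, (C1 * c^-1 + C2 * c' `^ (nu * p / (p - 1 - p * nu + 2 * nu))).
split=> //.
  by rewrite addr_gt0// mulr_gt0 ?invr_gt0// powR_gt0.
move=> delta alpha vdelta u d0 d1 ca ac' vd min_u.
have da0 : 0 < delta `^ a by rewrite powR_gt0.
have a0 : 0 < alpha by apply: lt_le_trans ca; rewrite mulr_gt0.
have r0 : 0 <= r by rewrite ltW// divr_gt0// !mulr_gt0//; lra.
(* The noise level and the parameter choice contribute the same power of delta,
   since r + a = 2. *)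
have noise : delta ^+ 2 / alpha <= c^-1 * delta `^ r.
  rewrite ler_pdivrMr// -(powR_mulrn 2 (ltW d0)).
  have -> : delta `^ 2 = delta `^ r * delta `^ a.
    rewrite -powRD; last by apply/implyP => _; rewrite gt_eqF.
    by congr (_ `^ _); rewrite /r /a; field; rewrite gt_eqF.
  rewrite -mulrA mulrCA; apply: ler_wpM2l; first exact: powR_ge0.
  by rewrite mulrC ler_pdivlMr// mulrC.
have noise1 : delta ^+ 2 / alpha <= c^-1.
  apply: le_trans noise _; rewrite ler_piMr ?invr_ge0 ?(ltW c0)//.
  by rewrite -(powRr0 delta) ger_powR// d0.
apply: le_trans (est _ _ _ _ d0 a0 noise1 vd min_u) _.
rewrite lee_fin (mulrDl (C1 / c)) lerD//.
  by rewrite -mulrA ler_pM2l.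
rewrite -(mulrA C2) ler_pM2l//.
have -> : delta `^ r = (delta `^ a) `^ (nu * p / (p - 1 - p * nu + 2 * nu)).
  rewrite -powRrM; congr (_ `^ _); rewrite /r /a; field.
  by rewrite !gt_eqF.
rewrite -powRM ?(ltW c'0) ?(ltW da0)//.
by rewrite ge0_ler_powR ?nnegrE ?(ltW a0)// mulr_ge0 ?(ltW c'0) ?(ltW da0).
Qed.
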